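(* Let $R$ be a commutative ring with unit $1\neq 0$. If $E$ is a row-finite graph, then $E$ satisfies Condition (K) if and only if every basic ideal in $L_R(E)$ is graded.
   Context: Graphs: a graph is a directed graph $E=(E^0,E^1,r,s)$ with countable sets $E^0$ (vertices), $E^1$ (edges) and maps $r,s:E^1\to E^0$ (range, source). It is row-finite if $s^{-1}(v)$ is finite for every $v\in E^0$. A vertex $v$ is regular, $v\in E^0_{\mathrm{reg}}$, if $0<|s^{-1}(v)|<\infty$. A path of length $n\ge 1$ is $\alpha=e_1\cdots e_n$ with $e_i\in E^1$ and $r(e_i)=s(e_{i+1})$; put $|\alpha|=n$, $s(\alpha)=s(e_1)$, $r(\alpha)=r(e_n)$. Vertices are paths of length $0$. $E^*$ is the set of all finite paths. For formal symbols $e^*$ ($e\in E^1$) put $\alpha^*:=e_n^*\cdots e_1^*$ and $v^*:=v$. A closed path is a path $\alpha=e_1\cdots e_n$ of length $n\ge1$ with $s(\alpha)=r(\alpha)$; this vertex is its base. It is simple if $s(e_i)\neq s(e_1)$ for $i=2,\dots,n$. $E$ satisfies Condition (K) if every vertex is either the base of no closed path or the base of at least two simple closed paths. Rings are not assumed commutative or unital. For $R$ a commutative ring with unit $1$, an $R$-algebra is a ring $A$ that is also a left $R$-module with $\lambda(xy)=(\lambda x)y=x(\lambda y)$ and $1\cdot x=x$; homomorphisms of $R$-algebras are $R$-linear ring homomorphisms. A Leavitt $E$-family in a ring is a collection $\{v,e,e^*:v\in E^0,e\in E^1\}$ of elements such that the $v$'s are pairwise orthogonal idempotents and: (1) $s(e)e=er(e)=e$;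 (2) $r(e)e^*=e^*s(e)=e^*$; (3) $e^*f=\delta_{e,f}\,r(e)$ for all $e,f\in E^1$; (4) $v=\sum_{s(e)=v}ee^*$ for every $v\in E^0_{\mathrm{reg}}$. The Leavitt path algebra $L_R(E)$ is the universal $R$-algebra generated by a Leavitt $E$-family $\{v,e,e^*\}$: every Leavitt $E$-family $\{a_v,b_e,c_{e^*}\}$ in an $R$-algebra $A$ is the image of the generators under an $R$-algebra homomorphism $L_R(E)\to A$ with $v\mapsto a_v$, $e\mapsto b_e$, $e^*\mapsto c_{e^*}$. Ideals are two-sided. $L_R(E)$ is $\mathbb{Z}$-graded by $L_R(E)_k=\{\sum_{i=1}^N \lambda_i\alpha_i\beta_i^*:\alpha_i,\beta_i\in E^*,\lambda_i\in R,|\alpha_i|-|\beta_i|=k\text{ for all }i\}$; an ideal $I$ is graded if $I=\bigoplus_{k\in\mathbb{Z}}(I\cap L_R(E)_k)$. An ideal $I$ of $L_R(E)$ is basic if whenever $\lambda\in R\setminus\{0\}$, $v\in E^0$ and $\lambda v\in I$, then $v\in I$. *)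

(* Defs.v *)
From HB Require Import structures.
From mathcomp Require Import all_boot all_order all_algebra.
From mathcomp Require Import finmap.
From mathcomp Require Import boolp classical_sets functions cardinality fsbigop.

Set Implicit Arguments.
Unset Strict Implicit.
Unset Printing Implicit Defensive.
Import GRing.Theory.
Local Open Scope classical_set_scope.
Local Open Scope ring_scope.

Record graph := Graph {
  vertex : countType;
  edge : countType;
  src : edge -> vertex;
  rng : edge -> vertex }.

Arguments src {g}.
Arguments rng {g}.

Section Graphs.
Variable E : graph.
Implicit Types v : vertex E.

Definition emitted v : set (edge E) := src @^-1` [set v].

Definition row_finite := forall v, finite_set (emitted v).

Definition regular v := emitted v !=set0 /\ finite_set (emitted v).

Fixpoint walk v (es : seq (edge E)) : bool :=
  if es is e :: es' then (src e == v) && walk (rng e) es' else true.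

(* The path (v, [::]) is the vertex v; a path of positive length is the     *)
(* sequence of its edges, together with its (then redundant) source.        *)
Definition gpath := {p : vertex E * seq (edge E) | walk p.1 p.2}.

Definition psrc (p : gpath) : vertex E := (val p).1.
Definition pedges (p : gpath) : seq (edge E) := (val p).2.
Definition plen (p : gpath) : nat := size (pedges p).
Definition prng (p : gpath) : vertex E := last (psrc p) (map rng (pedges p)).

Definition closed_path_at v (p : gpath) :=
  [/\ (0 < plen p)%N, psrc p = v & prng p = v].

Definition simple_closed_path_at v (p : gpath) :=
  closed_path_at v p /\ forall e, e \in behead (pedges p) -> src e <> v.

Definition condition_K := forall v,
  (forall p, ~ closed_path_at v p) \/
  (exists p q, [/\ p <> q, simple_closed_path_at v p
                 & simple_closed_path_at v q]).

End Graphs.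

(* Associative R-algebras without unit: the library's algebras are unital.  *)
HB.mixin Record Lmodule_isNuAlgebra (R : comNzRingType) A
    & GRing.Lmodule R A := {
  numul : A -> A -> A;
  numulA : associative numul;
  numulDl : left_distributive numul +%R;
  numulDr : right_distributive numul +%R;
  nuscalerAl : forall (a : R) (x y : A), a *: numul x y = numul (a *: x) y;
  nuscalerAr : forall (a : R) (x y : A), a *: numul x y = numul x (a *: y)
}.

#[short(type="nuAlgType")]
HB.structure Definition NuAlgebra (R : comNzRingType) :=
  {A of Lmodule_isNuAlgebra R A & GRing.Lmodule R A}.

Notation "x ** y" := (numul x y) (at level 40, left associativity) : ring_scope.

Definition nualg_hom (R : comNzRingType) (A B : nuAlgType R) (f : A -> B) :=
  linear f /\ {morph f : x y / x ** y}.

Record leavitt_family (R : comNzRingType) (E : graph) (A : nuAlgType R)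
    (pv : vertex E -> A) (pe pg : edge E -> A) : Prop := LeavittFamily {
  lf_idem : forall v, pv v ** pv v = pv v;
  lf_orth : forall v w, v <> w -> pv v ** pv w = 0;
  lf_src : forall e, pv (src e) ** pe e = pe e;
  lf_rng : forall e, pe e ** pv (rng e) = pe e;
  lf_grng : forall e, pv (rng e) ** pg e = pg e;
  lf_gsrc : forall e, pg e ** pv (src e) = pg e;
  lf_ck1 : forall e, pg e ** pe e = pv (rng e);
  lf_ck1_neq : forall e f, e <> f -> pg e ** pe f = 0;
  lf_ck2 : forall v, regular v ->
    pv v = \sum_(e \in emitted v) (pe e ** pg e) }.

(* L_R(E) is the algebra of formal expressions in the generators v, e, e^*, *)
(* modulo the congruence generated by the axioms of R-algebras and the      *)
(* relations of a Leavitt E-family; its universal property is established   *)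
(* in lpa_univ and lpa_univ_unique below.                                   *)
Section LeavittPathAlgebra.
Variables (R : comNzRingType) (E : graph).

Inductive lterm :=
| TVert of vertex E
| TEdge of edge E
| TGhost of edge E
| TZero
| TOpp of lterm
| TAdd of lterm & lterm
| TScale of R & lterm
| TMul of lterm & lterm.

HB.instance Definition _ := gen_eqMixin lterm.
HB.instance Definition _ := gen_choiceMixin lterm.

Definition tsum (s : seq lterm) : lterm := foldr TAdd TZero s.

Inductive lcong : lterm -> lterm -> Prop :=
| lc_refl x : lcong x x
| lc_sym x y : lcong x y -> lcong y x
| lc_trans x y z : lcong x y -> lcong y z -> lcong x z
| lc_opp x x' : lcong x x' -> lcong (TOpp x) (TOpp x')
| lc_add x x' y y' : lcong x x' -> lcong y y' -> lcong (TAdd x y) (TAdd x' y')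
| lc_scale a x x' : lcong x x' -> lcong (TScale a x) (TScale a x')
| lc_mul x x' y y' : lcong x x' -> lcong y y' -> lcong (TMul x y) (TMul x' y')
| lc_addA x y z : lcong (TAdd x (TAdd y z)) (TAdd (TAdd x y) z)
| lc_addC x y : lcong (TAdd x y) (TAdd y x)
| lc_add0 x : lcong (TAdd TZero x) x
| lc_addN x : lcong (TAdd (TOpp x) x) TZero
| lc_scaleA a b x : lcong (TScale a (TScale b x)) (TScale (a * b) x)
| lc_scale1 x : lcong (TScale 1 x) x
| lc_scaleDr a x y :
    lcong (TScale a (TAdd x y)) (TAdd (TScale a x) (TScale a y))
| lc_scaleDl a b x :
    lcong (TScale (a + b) x) (TAdd (TScale a x) (TScale b x))
| lc_mulA x y z : lcong (TMul x (TMul y z)) (TMul (TMul x y) z)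
| lc_mulDl x y z : lcong (TMul (TAdd x y) z) (TAdd (TMul x z) (TMul y z))
| lc_mulDr x y z : lcong (TMul x (TAdd y z)) (TAdd (TMul x y) (TMul x z))
| lc_scaleAl a x y : lcong (TScale a (TMul x y)) (TMul (TScale a x) y)
| lc_scaleAr a x y : lcong (TScale a (TMul x y)) (TMul x (TScale a y))
| lc_idem v : lcong (TMul (TVert v) (TVert v)) (TVert v)
| lc_orth v w : v <> w -> lcong (TMul (TVert v) (TVert w)) TZero
| lc_src e : lcong (TMul (TVert (src e)) (TEdge e)) (TEdge e)
| lc_rng e : lcong (TMul (TEdge e) (TVert (rng e))) (TEdge e)
| lc_grng e : lcong (TMul (TVert (rng e)) (TGhost e)) (TGhost e)
| lc_gsrc e : lcong (TMul (TGhost e) (TVert (src e))) (TGhost e)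
| lc_ck1 e : lcong (TMul (TGhost e) (TEdge e)) (TVert (rng e))
| lc_ck1_neq e f : e <> f -> lcong (TMul (TGhost e) (TEdge f)) TZero
| lc_ck2 v : regular v ->
    lcong (TVert v)
      (tsum [seq TMul (TEdge e) (TGhost e) | e <- fset_set (emitted v)]).

Definition lcongb : rel lterm := fun x y => `[< lcong x y >].

Lemma lcongb_equiv : equiv_class_of lcongb.
Proof.
split=> [x|x y|y x z].
- exact/asboolP/lc_refl.
- by apply/asboolP/asboolP; apply: lc_sym.
- by move=> /asboolP xy /asboolP yz; apply/asboolP/(lc_trans xy yz).
Qed.

Canonical lcongb_rel := EquivRelPack lcongb_equiv.

Definition lpa := {eq_quot lcongb_rel}%qT.

HB.instance Definition _ := Choice.on lpa.
HB.instance Definition _ := EqQuotient.on lpa.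

Definition lclass (t : lterm) : lpa := (\pi_lpa t)%qT.

Lemma lclassP x y : lclass x = lclass y <-> lcong x y.
Proof.
split=> [/eqP|xy]; last by apply/eqP; rewrite eqmodE; apply/asboolP.
by rewrite eqmodE => /asboolP.
Qed.

Lemma lreprK (x : lpa) : lclass (repr x) = x.
Proof. exact: reprK. Qed.

Lemma lrepr_cong t : lcong (repr (lclass t)) t.
Proof. by apply/lclassP; rewrite lreprK. Qed.

Definition lpa_add (x y : lpa) := lclass (TAdd (repr x) (repr y)).
Definition lpa_opp (x : lpa) := lclass (TOpp (repr x)).
Definition lpa_scale (a : R) (x : lpa) := lclass (TScale a (repr x)).
Definition lpa_mul (x y : lpa) := lclass (TMul (repr x) (repr y)).

Lemma lpa_addE s t : lpa_add (lclass s) (lclass t) = lclass (TAdd s t).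
Proof. by apply/lclassP/lc_add; apply: lrepr_cong. Qed.
Lemma lpa_oppE t : lpa_opp (lclass t) = lclass (TOpp t).
Proof. by apply/lclassP/lc_opp/lrepr_cong. Qed.
Lemma lpa_scaleE a t : lpa_scale a (lclass t) = lclass (TScale a t).
Proof. by apply/lclassP/lc_scale/lrepr_cong. Qed.
Lemma lpa_mulE s t : lpa_mul (lclass s) (lclass t) = lclass (TMul s t).
Proof. by apply/lclassP/lc_mul; apply: lrepr_cong. Qed.

Definition lpaE := (lpa_addE, lpa_oppE, lpa_scaleE, lpa_mulE).

Lemma lpa_addA : associative lpa_add.
Proof.
move=> x y z; rewrite -(lreprK x) -(lreprK y) -(lreprK z) !lpaE.
exact/lclassP/lc_addA.
Qed.
Lemma lpa_addC : commutative lpa_add.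
Proof.
by move=> x y; rewrite -(lreprK x) -(lreprK y) !lpaE; apply/lclassP/lc_addC.
Qed.
Lemma lpa_add0 : left_id (lclass TZero) lpa_add.
Proof. by move=> x; rewrite -(lreprK x) !lpaE; apply/lclassP/lc_add0. Qed.
Lemma lpa_addN : left_inverse (lclass TZero) lpa_opp lpa_add.
Proof. by move=> x; rewrite -(lreprK x) !lpaE; apply/lclassP/lc_addN. Qed.

HB.instance Definition _ :=
  GRing.isZmodule.Build lpa lpa_addA lpa_addC lpa_add0 lpa_addN.

Lemma lclass0 : lclass TZero = 0. Proof. by []. Qed.
Lemma lclassN t : lclass (TOpp t) = - lclass t. Proof. by rewrite -lpaE. Qed.
Lemma lclassD s t : lclass (TAdd s t) = lclass s + lclass t.
Proof. by rewrite -lpaE. Qed.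

Lemma lpa_scaleA a b x : lpa_scale a (lpa_scale b x) = lpa_scale (a * b) x.
Proof. by rewrite -(lreprK x) !lpaE; apply/lclassP/lc_scaleA. Qed.
Lemma lpa_scale1 : left_id 1 lpa_scale.
Proof. by move=> x; rewrite -(lreprK x) !lpaE; apply/lclassP/lc_scale1. Qed.
Lemma lpa_scaleDr : right_distributive lpa_scale +%R.
Proof.
move=> a x y; rewrite -(lreprK x) -(lreprK y) -lclassD !lpaE -lclassD.
exact/lclassP/lc_scaleDr.
Qed.
Lemma lpa_scaleDl x : {morph lpa_scale^~ x : a b / a + b}.
Proof.
by move=> a b; rewrite -(lreprK x) !lpaE -lclassD; apply/lclassP/lc_scaleDl.
Qed.

HB.instance Definition _ := GRing.Zmodule_isLmodule.Build R lpa
  lpa_scaleA lpa_scale1 lpa_scaleDr lpa_scaleDl.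

Lemma lclassZ a t : lclass (TScale a t) = a *: lclass t.
Proof. by rewrite -lpaE. Qed.

Lemma lpa_mulA : associative lpa_mul.
Proof.
move=> x y z; rewrite -(lreprK x) -(lreprK y) -(lreprK z) !lpaE.
exact/lclassP/lc_mulA.
Qed.
Lemma lpa_mulDl : left_distributive lpa_mul +%R.
Proof.
move=> x y z; rewrite -(lreprK x) -(lreprK y) -(lreprK z).
by rewrite -lclassD !lpaE -lclassD; apply/lclassP/lc_mulDl.
Qed.
Lemma lpa_mulDr : right_distributive lpa_mul +%R.
Proof.
move=> x y z; rewrite -(lreprK x) -(lreprK y) -(lreprK z).
by rewrite -lclassD !lpaE -lclassD; apply/lclassP/lc_mulDr.
Qed.
Lemma lpa_scaleAl (a : R) (x y : lpa) : a *: lpa_mul x y = lpa_mul (a *: x) y.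
Proof.
rewrite -(lreprK x) -(lreprK y) -lclassZ !lpaE -lclassZ.
exact/lclassP/lc_scaleAl.
Qed.
Lemma lpa_scaleAr (a : R) (x y : lpa) : a *: lpa_mul x y = lpa_mul x (a *: y).
Proof.
rewrite -(lreprK x) -(lreprK y) -lclassZ !lpaE -lclassZ.
exact/lclassP/lc_scaleAr.
Qed.

HB.instance Definition _ := Lmodule_isNuAlgebra.Build R lpa
  lpa_mulA lpa_mulDl lpa_mulDr lpa_scaleAl lpa_scaleAr.

Lemma lclassM s t : lclass (TMul s t) = lclass s ** lclass t.
Proof. by rewrite -lpaE. Qed.

Definition vert (v : vertex E) : lpa := lclass (TVert v).
Definition real (e : edge E) : lpa := lclass (TEdge e).
Definition ghost (e : edge E) : lpa := lclass (TGhost e).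

Lemma lclass_tsum (s : seq lterm) : lclass (tsum s) = \sum_(t <- s) lclass t.
Proof.
by elim: s => [|t s IHs]; rewrite ?big_nil// big_cons -IHs -lclassD.
Qed.

Lemma lpa_leavitt_family : leavitt_family vert real ghost.
Proof.
split; rewrite /vert /real /ghost; do ?[by move=> *; rewrite -lclassM;
  apply/lclassP; constructor].
move=> v [v0 vfin]; rewrite fsbig_finite//.
transitivity (lclass
  (tsum [seq TMul (TEdge e) (TGhost e) | e <- fset_set (emitted v)])).
  by apply/lclassP; constructor.
by rewrite lclass_tsum big_map; under eq_bigr do rewrite lclassM.
Qed.

Section Universal.
Variables (A : nuAlgType R) (pv : vertex E -> A) (pe pg : edge E -> A).

Fixpoint leval (t : lterm) : A :=
  match t with
  | TVert v => pv v
  | TEdge e => pe e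
  | TGhost e => pg e
  | TZero => 0
  | TOpp x => - leval x
  | TAdd x y => leval x + leval y
  | TScale a x => a *: leval x
  | TMul x y => leval x ** leval y
  end.

Hypothesis pP : leavitt_family pv pe pg.

Lemma leval_cong s t : lcong s t -> leval s = leval t.
Proof.
elim=> //=; do ?[by move=> *; congruence].
- by move=> *; rewrite addrA.
- by move=> *; rewrite addrC.
- by move=> *; rewrite add0r.
- by move=> *; rewrite addNr.
- by move=> *; rewrite scalerA.
- by move=> *; rewrite scale1r.
- by move=> *; rewrite scalerDr.
- by move=> *; rewrite scalerDl.
- by move=> *; rewrite numulA.
- by move=> *; rewrite numulDl.
- by move=> *; rewrite numulDr.
- by move=> *; rewrite nuscalerAl.
- by move=> *; rewrite nuscalerAr.
- exact: lf_idem pP.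
- exact: lf_orth pP.
- exact: lf_src pP.
- exact: lf_rng pP.
- exact: lf_grng pP.
- exact: lf_gsrc pP.
- exact: lf_ck1 pP.
- exact: lf_ck1_neq pP.
- move=> v vreg; rewrite (lf_ck2 pP vreg) fsbig_finite//; last by case: vreg.
  have -> s' : leval (tsum s') = \sum_(t <- s') leval t.
    by elim: s' => [|x s' IHs]; rewrite ?big_nil// big_cons -IHs.
  by rewrite big_map.
Qed.

Lemma lpa_univ : exists phi : lpa -> A,
  [/\ nualg_hom phi, forall v, phi (vert v) = pv v,
      forall e, phi (real e) = pe e & forall e, phi (ghost e) = pg e].
Proof.
exists (fun x => leval (repr x)).
have E' t : leval (repr (lclass t)) = leval t by apply/leval_cong/lrepr_cong.
split; try by move=> *; rewrite E'.
split=> [a x y|x y]; rewrite -(lreprK x) -(lreprK y).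
- by rewrite -lclassZ -lclassD !E'.
- by rewrite -lclassM !E'.
Qed.

End Universal.

Lemma lpa_univ_unique (A : nuAlgType R) (phi psi : lpa -> A) :
    nualg_hom phi -> nualg_hom psi ->
    (forall v, phi (vert v) = psi (vert v)) ->
    (forall e, phi (real e) = psi (real e)) ->
    (forall e, phi (ghost e) = psi (ghost e)) ->
  phi =1 psi.
Proof.
move=> [phiL phiM] [psiL psiM] hv he hg x; rewrite -(lreprK x).
have lin0 (f : lpa -> A) : linear f -> f 0 = 0.
  by move=> fL; have := fL (-1) 0 0; rewrite !scaleN1r !addNr.
have linZ (f : lpa -> A) : linear f -> forall a y, f (a *: y) = a *: f y.
  by move=> fL a y; have := fL a y 0; rewrite lin0// !addr0.
have linD (f : lpa -> A) : linear f -> forall y z, f (y + z) = f y + f z.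
  by move=> fL y z; have := fL 1 y z; rewrite !scale1r.
elim: (repr x) => [v|e|e||t IHt|s IHs t IHt|a t IHt|s IHs t IHt].
- exact: hv.
- exact: he.
- exact: hg.
- by rewrite !lin0.
- by rewrite lclassN -scaleN1r !linZ// IHt.
- by rewrite lclassD !linD// IHs IHt.
- by rewrite lclassZ !linZ// IHt.
- by rewrite lclassM phiM psiM IHs IHt.
Qed.

(* There is no unit to serve as empty product: the default d is used below  *)
(* for the vertex of a path of length 0.                                    *)
Definition nuprod (A : nuAlgType R) (d : A) (s : seq A) : A :=
  if s is x :: s' then foldl numul x s' else d.

Definition path_real (p : gpath E) : lpa :=
  nuprod (vert (psrc p)) (map real (pedges p)).

Definition path_ghost (p : gpath E) : lpa :=
  nuprod (vert (psrc p)) (rev (map ghost (pedges p))).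

Definition lpa_homog (k : int) : set lpa :=
  [set x | exists s : seq (R * gpath E * gpath E),
     (forall t, t \in s -> (plen t.1.2)%:Z - (plen t.2)%:Z = k) /\
     x = \sum_(t <- s) t.1.1 *: (path_real t.1.2 ** path_ghost t.2)].

Definition basic (I : set lpa) :=
  forall (a : R) v, a <> 0 -> I (a *: vert v) -> I (vert v).

End LeavittPathAlgebra.

(* Ring ideals; as every element of L_R(E) has a local unit, those of       *)
(* L_R(E) are stable under scaling by R.                                    *)
Definition two_sided_ideal (R : comNzRingType) (A : nuAlgType R) (I : set A) :=
  [/\ I 0, forall x y, I x -> I y -> I (x - y),
      forall a x, I x -> I (a ** x) & forall a x, I x -> I (x ** a)].

Definition decomposition (V : zmodType) (M : int -> set V) (x : V)
    (c : int -> V) :=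
  [/\ forall k, M k (c k), finite_set [set k | c k <> 0]
    & x = \sum_(k \in [set: int]) c k].

Definition internal_direct_sum (V : zmodType) (I : set V)
    (M : int -> set V) :=
  (forall x, I x <-> exists c, decomposition M x c) /\
  (forall x c d, decomposition M x c -> decomposition M x d -> c =1 d).

Definition graded (R : comNzRingType) (E : graph) (I : set (lpa R E)) :=
  internal_direct_sum I (fun k => I `&` lpa_homog k).

(* Main.v *)
Require Import Defs.
From HB Require Import structures.
From mathcomp Require Import all_boot all_order all_algebra.
From mathcomp Require Import finmap zify.
From mathcomp Require Import boolp classical_sets functions cardinality fsbigop.

(** Condition (K) implies that basic ideals are graded.  Let [x] belong to a
    basic ideal [I]; it must be written as a sum of homogeneous elements of
    [I].  Cutting [x] by vertices, and expanding a vertex [w] that is not a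
    sink as the sum of the [e e^*], one may replace [x] by the products [x e],
    whose ghost paths are shorter, until [x] is a combination of real paths
    ending at one vertex [w].  Let [a] be a shortest path of [x] with
    coefficient [r <> 0].  Then [a^* x = r w + y], where [y] is a combination
    of closed paths of positive length at [w].  Condition (K) provides two
    simple closed paths [p <> q] at [w], and for [N] large the path
    [m = p^N q] satisfies [m^* g m = 0] for every closed path [g] of [y], while
    [m^* m = w] ([power_not_prefix]).  So [r w], hence [w], lies in [I]
    ([vertex_in_basic]), and with it every term of [x].

    Conversely let [v] be the base of closed paths but only of one simple
    closed path [p].  An infinite path that starts at [v] and visits [v]
    infinitely often can only be [p p p ...] ([recurrent_unique]).  Let
    [L_R(E)] act on the [R]-valued functions on the infinite paths that visit
    [v] infinitely often: for an edge [e], the value of [e f] at [e x] is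
    [f x], and [e f] vanishes at the paths that do not start with [e].  The
    kernel of this representation is basic because a vertex acts as
    restriction of functions to a set of paths, it contains [v - p] because
    removing [p] from [p p p ...] changes nothing, and it does not contain [v].
    It is therefore not graded.

    Both directions use that [L_R(E)] is the direct sum of its homogeneous
    parts; this is read off a representation of [L_R(E)] on [int -> L_R(E)]
    that records degrees ([graded_component]). *)

Set Implicit Arguments.
Unset Strict Implicit.
Unset Printing Implicit Defensive.
Import GRing.Theory.
Local Open Scope classical_set_scope.
Local Open Scope ring_scope.

(** * The algebra of endomorphisms of a module *)

Section Endomorphisms.
Variables (R : comNzRingType) (M : lmodType R).

Definition is_linear : {pred M -> M} := fun f => `[< linear f >].

Lemma is_linear_submod : submod_closed is_linear.
Proof.
split=> [|a f g /asboolP fL /asboolP gL]; apply/asboolP => b x y.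
  by rewrite /GRing.zero /= scaler0 addr0.
rewrite -![(a *: f + g) _]/(a *: f _ + g _) fL gL !scalerDr !scalerA (mulrC a).
by rewrite addrACA.
Qed.

HB.instance Definition _ :=
  GRing.isSubmodClosed.Build R (M -> M) is_linear is_linear_submod.

(** Composition makes this an associative algebra; both representations below
    take their values in algebras of this kind. *)
Record endo := Endo {efun :> M -> M; _ : is_linear efun}.

HB.instance Definition _ := [isSub for efun].
HB.instance Definition _ := [Choice of endo by <:].
HB.instance Definition _ := [SubChoice_isSubLmodule of endo by <:].

Lemma endo_linear (f : endo) : linear f.
Proof. by case: f => f /= /asboolP. Qed.

Lemma comp_is_linear (f g : endo) : is_linear (f \o g).
Proof. by apply/asboolP => a x y /=; rewrite !endo_linear. Qed.

Definition endo_mul (f g : endo) : endo := Endo (comp_is_linear f g).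

Lemma endoP (f g : endo) : (forall x, f x = g x) -> f = g.
Proof. by move=> fg; apply/val_inj/funext. Qed.

Lemma endoD (f g : endo) x : (f + g) x = f x + g x. Proof. by []. Qed.
Lemma endoZ a (f : endo) x : (a *: f) x = a *: f x. Proof. by []. Qed.
Lemma endoN (f : endo) x : (- f) x = - f x. Proof. by []. Qed.

Lemma endo_mulA : associative endo_mul.
Proof. by move=> f g h; apply: endoP. Qed.
Lemma endo_mulDl : left_distributive endo_mul +%R.
Proof. by move=> f g h; apply: endoP. Qed.
Lemma endo_mulDr : right_distributive endo_mul +%R.
Proof.
move=> f g h; apply: endoP => x.
by rewrite /= -[X in f (X + _)]scale1r endo_linear scale1r.
Qed.
Lemma endo_scaleAl (a : R) (f g : endo) :
  a *: endo_mul f g = endo_mul (a *: f) g.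
Proof. exact: endoP. Qed.
Lemma endo_scaleAr (a : R) (f g : endo) :
  a *: endo_mul f g = endo_mul f (a *: g).
Proof.
have f0 : f 0 = 0 by have := endo_linear f (-1) 0 0; rewrite !scaleN1r !addNr.
apply: endoP => x; rewrite endoZ /= -[X in _ = f X]addr0 endo_linear f0.
by rewrite addr0.
Qed.

HB.instance Definition _ := Lmodule_isNuAlgebra.Build R endo
  endo_mulA endo_mulDl endo_mulDr endo_scaleAl endo_scaleAr.

Lemma endoM (f g : endo) x : (f ** g) x = f (g x). Proof. by []. Qed.

Lemma endo_sum I (r : seq I) (F : I -> endo) x :
  (\sum_(i <- r) F i) x = \sum_(i <- r) F i x.
Proof. by elim: r => [|i r IH]; rewrite ?big_nil// !big_cons endoD IH. Qed.

End Endomorphisms.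

(** * Calculus in algebras without unit *)

Section NonUnital.
Variables (R : comNzRingType) (A : nuAlgType R).

Lemma numul0l (x : A) : 0 ** x = 0.
Proof. by apply: (@addrI _ (0 ** x)); rewrite -numulDl !addr0. Qed.
Lemma numul0r (x : A) : x ** 0 = 0.
Proof. by apply: (@addrI _ (x ** 0)); rewrite -numulDr !addr0. Qed.
Lemma numulNl (x y : A) : (- x) ** y = - (x ** y).
Proof. by apply: (@addrI _ (x ** y)); rewrite -numulDl !subrr numul0l. Qed.
Lemma numulNr (x y : A) : x ** (- y) = - (x ** y).
Proof. by apply: (@addrI _ (x ** y)); rewrite -numulDr !subrr numul0r. Qed.
Lemma numul_suml I (r : seq I) (P : pred I) (F : I -> A) y :
  (\sum_(i <- r | P i) F i) ** y = \sum_(i <- r | P i) F i ** y.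
Proof.
by apply: (big_morph (fun x => x ** y)) => [x z|]; rewrite ?numulDl ?numul0l.
Qed.
Lemma numul_sumr I (r : seq I) (P : pred I) (F : I -> A) y :
  y ** (\sum_(i <- r | P i) F i) = \sum_(i <- r | P i) y ** F i.
Proof.
by apply: (big_morph (fun x => y ** x)) => [x z|]; rewrite ?numulDr ?numul0r.
Qed.

End NonUnital.

Section Homomorphisms.
Variables (R : comNzRingType) (A B : nuAlgType R).
Variables (f : A -> B) (fP : nualg_hom f).

Lemma nualg_homZD a x y : f (a *: x + y) = a *: f x + f y.
Proof. by case: fP => fL _; rewrite fL. Qed.
Lemma nualg_homM x y : f (x ** y) = f x ** f y.
Proof. by case: fP. Qed.
Lemma nualg_homD x y : f (x + y) = f x + f y.
Proof. by rewrite -[x]scale1r nualg_homZD !scale1r. Qed.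
Lemma nualg_hom0 : f 0 = 0.
Proof. by apply: (@addrI _ (f 0)); rewrite -nualg_homD !addr0. Qed.
Lemma nualg_homN x : f (- x) = - f x.
Proof. by apply: (@addrI _ (f x)); rewrite -nualg_homD !subrr nualg_hom0. Qed.
Lemma nualg_homZ a x : f (a *: x) = a *: f x.
Proof. by rewrite -[a *: x]addr0 nualg_homZD nualg_hom0 addr0. Qed.

Lemma two_sided_ideal_ker : two_sided_ideal [set x | f x = 0].
Proof.
split=> /= [|x y x0 y0|a x x0|a x x0].
- exact: nualg_hom0.
- by rewrite nualg_homD nualg_homN x0 y0 subrr.
- by rewrite nualg_homM x0 numul0r.
- by rewrite nualg_homM x0 numul0l.
Qed.

End Homomorphisms.

Section Ideals.
Variables (R : comNzRingType) (A : nuAlgType R) (I : set A).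
Hypothesis II : two_sided_ideal I.

Lemma nuideal0 : I 0. Proof. by case: II. Qed.
Lemma nuidealB x y : I x -> I y -> I (x - y).
Proof. by case: II => _ + _ _; apply. Qed.
Lemma nuidealD x y : I x -> I y -> I (x + y).
Proof.
move=> Ix Iy; rewrite -[y]opprK -[- y]sub0r.
by do ?apply: nuidealB => //; apply: nuideal0.
Qed.
Lemma nuidealMl a x : I x -> I (a ** x).
Proof. by case: II => _ _ + _; apply. Qed.
Lemma nuidealMr a x : I x -> I (x ** a).
Proof. by case: II => _ _ _; apply. Qed.

End Ideals.

(** * Monomials of a Leavitt path algebra *)

Section Monomials.
Variables (R : comNzRingType) (E : graph).
Local Notation L := (lpa R E).
Local Notation vert := (@vert R E).
Local Notation real := (@real R E).
Local Notation ghost := (@ghost R E).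
Implicit Types (v w : vertex E) (e f : edge E) (s t : seq (edge E)).

Let LF := lpa_leavitt_family R E.

Lemma vertM v w : vert v ** vert w = if v == w then vert v else 0.
Proof.
by case: eqP => [<-|vw]; [apply: lf_idem LF v | apply: (lf_orth LF)].
Qed.

Lemma vert_real v e : vert v ** real e = if src e == v then real e else 0.
Proof.
rewrite -[real e in LHS](lf_src LF) numulA vertM eq_sym.
by case: eqP => [<-|_]; rewrite ?(lf_src LF) ?numul0l.
Qed.

Lemma real_vert v e : real e ** vert v = if rng e == v then real e else 0.
Proof.
rewrite -[real e in LHS](lf_rng LF) -numulA vertM.
by case: eqP => _; rewrite ?(lf_rng LF) ?numul0r.
Qed.

Lemma vert_ghost v e : vert v ** ghost e = if rng e == v then ghost e else 0.
Proof.
rewrite -[ghost e in LHS](lf_grng LF) numulA vertM eq_sym.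
by case: eqP => [<-|_]; rewrite ?(lf_grng LF) ?numul0l.
Qed.

Lemma ghost_vert v e : ghost e ** vert v = if src e == v then ghost e else 0.
Proof.
rewrite -[ghost e in LHS](lf_gsrc LF) -numulA vertM.
by case: eqP => _; rewrite ?(lf_gsrc LF) ?numul0r.
Qed.

Lemma ghost_real e f : ghost e ** real f = if e == f then vert (rng e) else 0.
Proof.
by case: eqP => [<-|ef]; [apply: lf_ck1 LF e | apply: (lf_ck1_neq LF)].
Qed.

Definition pend v s := last v (map rng s).

Lemma pend_cat v s t : pend v (s ++ t) = pend (pend v s) t.
Proof. by rewrite /pend map_cat last_cat. Qed.

Lemma walk_cat v s t : walk v (s ++ t) = walk v s && walk (pend v s) t.
Proof.
by elim: s v => //= e s IH v; rewrite IH andbA.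
Qed.

(** The product [v e_1 ... e_n] of an arbitrary sequence of edges vanishes
    unless the sequence is a walk from [v], so the computations below carry no
    side condition. *)
Definition realw v s : L := foldl numul (vert v) (map real s).
(** The element [(e_1 ... e_n)^*]; the vertex [v] only counts for the empty
    sequence. *)
Fixpoint ghostw v s : L :=
  if s is e :: s' then ghostw (rng e) s' ** ghost e else vert v.

Lemma realw_rcons v s e : realw v (rcons s e) = realw v s ** real e.
Proof. by rewrite /realw map_rcons -cats1 foldl_cat. Qed.

Lemma foldl_numul (A : nuAlgType R) (x y : A) r :
  foldl numul (x ** y) r = x ** foldl numul y r.
Proof. by elim: r y => //= z r IH y; rewrite -numulA IH. Qed.

Lemma realw_cons v e s :
  realw v (e :: s) = if src e == v then real e ** realw (rng e) s else 0.
Proof.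
rewrite /realw /= vert_real; case: eqP => _.
  by rewrite -foldl_numul (lf_rng LF).
by elim: s => //= f s IH; rewrite numul0l.
Qed.

Lemma vert_realw v w s : vert v ** realw w s = if v == w then realw w s else 0.
Proof.
rewrite /realw -foldl_numul vertM; case: eqP => [->//|_].
by elim: s => //= f s IH; rewrite numul0l.
Qed.

Lemma realw_nwalk v s : ~~ walk v s -> realw v s = 0.
Proof.
elim: s v => //= e s IH v; rewrite realw_cons; case: eqP => //= _ /IH ->.
by rewrite numul0r.
Qed.

Lemma realw_vert v s w :
  realw v s ** vert w = if pend v s == w then realw v s else 0.
Proof.
elim/last_ind: s => [|s e _].
  by rewrite vertM /pend /=; case: eqP => // ->.
rewrite realw_rcons -numulA real_vert /pend map_rcons last_rcons.
by case: eqP => _; rewrite ?numul0r.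
Qed.

Lemma realw_cat v s t : realw v (s ++ t) = realw v s ** realw (pend v s) t.
Proof.
elim/last_ind: t => [|t e IH].
  by rewrite cats0 /= [realw _ [::]]/realw /= realw_vert eqxx.
by rewrite -rcons_cat !realw_rcons IH numulA.
Qed.

(** Each edge of [s] is cancelled against the edge of [t] in the same place, or
    the product dies at the first difference. *)
Lemma ghostw_realw v s w t : walk v s -> (size s <= size t)%N ->
  ghostw v s ** realw w t =
  if (v == w) && prefix s t then realw (pend v s) (drop (size s) t) else 0.
Proof.
elim: s v w t => [|e s IH] v w t /=.
  by rewrite prefix0s drop0 andbT vert_realw /pend /=; case: eqP => // ->.
case/andP=> /eqP sv ws; case: t => // f t /= st.
rewrite realw_cons -numulA; case: (src f =P w) => [fw|fw]; last first.
  rewrite !numul0r; case: eqP => //= vw; case: eqP => //= ef.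
  by case: fw; rewrite -ef sv.
rewrite (numulA (ghost e)) ghost_real; case: (e =P f) fw => /= [<- fw|_ _].
  by rewrite vert_realw eqxx IH// -sv -fw !eqxx.
by rewrite numul0l numul0r andbF.
Qed.

Lemma ghostw_ghost w t e : ghostw w t ** ghost e =
  if (t != [::]) || (rng e == w) then ghostw (rng e) (e :: t) else 0.
Proof.
by case: t => [|f t] //=; rewrite vert_ghost (lf_grng LF).
Qed.

(** The source of the path [t] whose ghost is [ghostw w t]: [w] stands for the
    vertex when [t] is empty. *)
Definition gsrc w t := if t is e :: _ then src e else w.

Lemma ghostw_vert w t u :
  ghostw w t ** vert u = if gsrc w t == u then ghostw w t else 0.
Proof.
case: t => [|e t] /=; first by rewrite vertM; case: eqP => // ->.
by rewrite -numulA ghost_vert; case: eqP; rewrite ?numul0r.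
Qed.

Lemma ghostw_nwalk w t : ~~ walk (gsrc w t) t -> ghostw w t = 0.
Proof.
case: t => //= e t; rewrite eqxx /=; elim: t e => //= f t IH e.
case: (src f =P rng e) => [_ /IH -> | fe _]; first by rewrite numul0l.
rewrite -numulA -[ghost e](lf_grng LF) (numulA (ghost f)) ghost_vert.
by case: eqP fe => // _ _; rewrite numul0l numul0r.
Qed.

Definition mono v s w t : L := realw v s ** ghostw w t.

Lemma mono_vert v s w t u :
  mono v s w t ** vert u = if gsrc w t == u then mono v s w t else 0.
Proof. by rewrite /mono -numulA ghostw_vert; case: eqP; rewrite ?numul0r. Qed.

Lemma mono_ghost v s w t e : mono v s w t ** ghost e = 0 \/
  mono v s w t ** ghost e = mono v s (rng e) (e :: t).
Proof.
rewrite /mono -numulA ghostw_ghost; case: ifP => _; first by right.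
by left; rewrite numul0r.
Qed.

(** Right multiplication by an edge cancels a ghost edge, or lengthens the real
    path when there is no ghost edge left: in both cases the degree grows by
    one and the ghost path gets shorter, if it can. *)
Lemma mono_real v s w t e : mono v s w t ** real e = 0 \/
  exists s' w' t', [/\ mono v s w t ** real e = mono v s' w' t',
    (size s' + size t = (size s + size t').+1)%N & (size t' <= (size t).-1)%N].
Proof.
rewrite /mono; case: t => [|f t] /=; rewrite -numulA.
  rewrite vert_real; case: eqP => _; last by left; rewrite numul0r.
  right; exists (rcons s e), (rng e), [::].
  rewrite size_rcons !addn0; split=> //=.
  by rewrite realw_vert /pend map_rcons last_rcons eqxx realw_rcons.
rewrite -numulA ghost_real; case: eqP => _; last by left; rewrite !numul0r.
rewrite ghostw_vert; case: eqP => _; last by left; rewrite !numul0r.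
by right; exists s, (rng f), t; rewrite addnS.
Qed.

(** The monomials span the algebra: their span contains the generators and is
    stable under right multiplication by them. *)
Lemma lpa_ind (P : L -> Prop) : P 0 -> (forall x y, P x -> P y -> P (x + y)) ->
  (forall a v s w t, P (a *: mono v s w t)) -> forall x, P x.
Proof.
move=> P0 PD PM.
pose S (x : L) := exists l : seq (R * (vertex E * seq (edge E)) *
    (vertex E * seq (edge E))),
  x = \sum_(i <- l) i.1.1 *: mono i.1.2.1 i.1.2.2 i.2.1 i.2.2.
have S0 : S 0 by exists [::]; rewrite big_nil.
have SD x y : S x -> S y -> S (x + y).
  by move=> [l ->] [l' ->]; exists (l ++ l'); rewrite big_cat.
have SM a v s w t : S (a *: mono v s w t).
  by exists [:: (a, (v, s), (w, t))]; rewrite big_seq1.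
have SP x (Q : L -> Prop) : Q 0 -> (forall x y, Q x -> Q y -> Q (x + y)) ->
    (forall a v s w t, Q (a *: mono v s w t)) -> S x -> Q x.
  by move=> Q0 QD QM [l ->]; elim/big_rec: _ => // i y _; apply: QD.
have SZ a x : S x -> S (a *: x).
  apply: (SP _ (fun x => S (a *: x))) => [|y z Sy Sz|b v s w t].
  - by rewrite scaler0.
  - by rewrite scalerDr; apply: SD.
  - by rewrite scalerA.
have SR g x : (forall v s w t, S (mono v s w t ** g)) -> S x -> S (x ** g).
  move=> Sg; apply: (SP _ (fun x => S (x ** g))) => [|y z Sy Sz|b v s w t].
  - by rewrite numul0l.
  - by rewrite numulDl; apply: SD.
  - by rewrite -nuscalerAl; apply: SZ.
have S1 v s w t : S (mono v s w t) by rewrite -[mono _ _ _ _]scale1r.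
have SRv u x : S x -> S (x ** vert u).
  by apply: SR => *; rewrite mono_vert; case: ifP.
have SRe e x : S x -> S (x ** real e).
  apply: SR => v s w t.
  by have [->//|[s' [w' [t' [-> _ _]]]]] := mono_real v s w t e; apply: S1.
have SRg e x : S x -> S (x ** ghost e).
  by apply: SR => v s w t; have [->|->] := mono_ghost v s w t e.
have Sv v : S (vert v).
  by have := S1 v [::] v [::]; rewrite /mono /realw /= vertM eqxx.
move=> x; apply: (SP x P) => //; rewrite -(lreprK x).
suff: S (lclass (repr x)) /\ forall y, S y -> S (y ** lclass (repr x)) by case.
elim: (repr x) => [v|e|e||t [St IHt]|s [Ss IHs] t [St IHt]|a t [St IHt]|
  s [Ss IHs] t [St IHt]].
- by split=> [|y]; [apply: Sv | apply: SRv].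
- split=> [|y]; last exact: SRe.
  by rewrite -/(real e) -(lf_src LF); apply/SRe/Sv.
- split=> [|y]; last exact: SRg.
  by rewrite -/(ghost e) -(lf_grng LF); apply/SRg/Sv.
- by split=> [|y Sy]; rewrite lclass0 ?numul0r.
- rewrite lclassN -scaleN1r; split=> [|y Sy]; first exact: SZ.
  by rewrite -nuscalerAr; apply/SZ/IHt.
- rewrite lclassD; split=> [|y Sy]; first exact: SD.
  by rewrite numulDr; apply: SD; do ?[apply: IHs | apply: IHt].
- rewrite lclassZ; split=> [|y Sy]; first exact: SZ.
  by rewrite -nuscalerAr; apply/SZ/IHt.
- rewrite lclassM; split=> [|y Sy]; first exact: IHt.
  by rewrite numulA; apply/IHt/IHs.
Qed.

End Monomials.

(** * The grading *)

Section Grading.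
Variables (R : comNzRingType) (E : graph).
Local Notation L := (lpa R E).
Local Notation vert := (@vert R E).
Local Notation real := (@real R E).
Local Notation ghost := (@ghost R E).
Implicit Types (v w : vertex E) (e : edge E) (s t : seq (edge E)).
Implicit Types (k : int) (x : L).

Let LF := lpa_leavitt_family R E.

Lemma path_realE (p : gpath E) : path_real R p = realw R (psrc p) (pedges p).
Proof.
case: p => [[v [|e s]] /=] //; rewrite /path_real /psrc /pedges /=.
move=> /andP[/eqP <- _].
by rewrite /realw /= (lf_src LF).
Qed.

Lemma path_ghostE (p : gpath E) : path_ghost R p = ghostw R (psrc p) (pedges p).
Proof.
case: p => [[v s] /= w_s]; rewrite /path_ghost /psrc /pedges /= {w_s}.
elim: s v => //= e s IH v; rewrite -(IH (rng e)) rev_cons.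
case: (rev _) => [|x r] /=; first by rewrite (lf_grng LF).
by rewrite -cats1 foldl_cat.
Qed.

Lemma lpa_homog0 k : lpa_homog k (0 : L).
Proof. by exists [::]; rewrite big_nil. Qed.

Lemma lpa_homogD k x y : lpa_homog k x -> lpa_homog k y -> lpa_homog k (x + y).
Proof.
move=> [l [lk ->]] [l' [lk' ->]].
exists (l ++ l'); rewrite big_cat; split=> // t.
by rewrite mem_cat => /orP[/lk|/lk'].
Qed.

Lemma lpa_homogZ k a x : lpa_homog k x -> lpa_homog k (a *: x).
Proof.
move=> [l [lk ->]]; exists [seq (a * i.1.1, i.1.2, i.2) | i <- l]; split.
  by move=> t /mapP[u /lk + ->].
by rewrite scaler_sumr big_map; apply: eq_bigr => t _; rewrite scalerA.
Qed.

(** Sequences that are not walks cause no harm: their monomial is zero. *)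
Lemma lpa_homog_mono v s w t :
  lpa_homog ((size s)%:Z - (size t)%:Z) (mono R v s w t).
Proof.
have [ws|/realw_nwalk ws] := boolP (walk v s); last first.
  by rewrite /mono ws numul0l; apply: lpa_homog0.
have [wt|/ghostw_nwalk wt] := boolP (walk (gsrc w t) t); last first.
  by rewrite /mono wt numul0r; apply: lpa_homog0.
exists [:: (1, exist _ (v, s) ws, exist _ (gsrc w t, t) wt)]; split.
  by move=> u; rewrite inE => /eqP ->.
rewrite big_seq1 scale1r path_realE path_ghostE /mono; congr (_ ** _).
by rewrite /psrc /pedges /=; clear wt; case: t.
Qed.

Lemma lpa_homog_real v s : lpa_homog (size s)%:Z (realw R v s).
Proof.
have := lpa_homog_mono v s (pend v s) [::].
by rewrite subr0 /mono /= realw_vert eqxx.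
Qed.

Lemma lpa_homog_ind k (P : L -> Prop) : P 0 ->
  (forall x y, P x -> P y -> P (x + y)) ->
  (forall a v s w t, (size s)%:Z - (size t)%:Z = k ->
    P (a *: mono R v s w t)) ->
  forall x, lpa_homog k x -> P x.
Proof.
move=> P0 PD PM x [l [lk ->]]; rewrite big_seq.
elim/big_rec: _ => // t y /lk tk.
by apply: PD; rewrite path_realE path_ghostE; apply: PM.
Qed.

Lemma lpa_homog_ghost k x e : lpa_homog k x -> lpa_homog (k - 1) (x ** ghost e).
Proof.
apply: (lpa_homog_ind (P := fun x => lpa_homog (k - 1) (x ** ghost e)))
  => [|y z yk zk|a v s w t tk].
- by rewrite numul0l; apply: lpa_homog0.
- by rewrite numulDl; apply: lpa_homogD.
rewrite -nuscalerAl; apply: lpa_homogZ.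
have [->|->] := mono_ghost R v s w t e; first exact: lpa_homog0.
have -> : k - 1 = (size s)%:Z - (size (e :: t))%:Z by rewrite /= -tk; lia.
exact: lpa_homog_mono.
Qed.

Local Notation M := (int -> L).

Lemma shift_mul_linear x k : is_linear (fun (f : M) n => x ** f (n - k)).
Proof.
apply/asboolP => a f g; apply/funext => n.
rewrite -![(a *: _ + _) _]/(a *: _ + _ : L).
by rewrite numulDr nuscalerAr.
Qed.

(** On formal series in [z] and [z^-1] with coefficients in [L], this is left
    multiplication by [x z^k]. *)
Definition shift_mul x k : endo M := Endo (shift_mul_linear x k).

Lemma shift_mulE x k f n : shift_mul x k f n = x ** f (n - k).
Proof. by []. Qed.

Lemma shift_mulM x y k j :
  shift_mul x k ** shift_mul y j = shift_mul (x ** y) (k + j).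
Proof.
apply: endoP => f; apply/funext => n; rewrite endoM !shift_mulE numulA.
by rewrite opprD addrA.
Qed.

Lemma shift_mul0 k : shift_mul 0 k = 0.
Proof. by apply: endoP => f; apply/funext => n; rewrite shift_mulE numul0l. Qed.

Lemma shift_mulD x y k : shift_mul (x + y) k = shift_mul x k + shift_mul y k.
Proof.
by apply: endoP => f; apply/funext => n; rewrite shift_mulE numulDl.
Qed.

Lemma shift_mulZ a x k : shift_mul (a *: x) k = a *: shift_mul x k.
Proof.
by apply: endoP => f; apply/funext => n; rewrite shift_mulE -nuscalerAl.
Qed.

Lemma shift_mul_leavitt : leavitt_family (fun v => shift_mul (vert v) 0)
  (fun e => shift_mul (real e) 1) (fun e => shift_mul (ghost e) (- 1)).
Proof.
split=> [v|v w vw|e|e|e|e|e|e f ef|v vr];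
  rewrite ?shift_mulM ?addr0 ?add0r ?subrr ?addNr.
- by rewrite (lf_idem LF).
- by rewrite (lf_orth LF) ?shift_mul0.
- by rewrite (lf_src LF).
- by rewrite (lf_rng LF).
- by rewrite (lf_grng LF).
- by rewrite (lf_gsrc LF).
- by rewrite (lf_ck1 LF).
- by rewrite (lf_ck1_neq LF) ?shift_mul0.
rewrite (lf_ck2 LF vr) !fsbig_finite; do ?by case: vr.
rewrite (big_morph (fun x => shift_mul x 0) (fun x y => shift_mulD x y 0)
  (shift_mul0 0)).
by apply: eq_bigr => e _; rewrite shift_mulM subrr.
Qed.

(** The components of an element are determined by the element: a homogeneous
    [x] of degree [k] acts as multiplication by [x z^k], and so sends the
    series [u z^0] to [x u z^k].  The factor [u] is there because [L] may have
    no unit. *)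
Lemma graded_component : exists pr : L -> int -> L -> L,
  (forall u n x y, pr u n (x + y) = pr u n x + pr u n y) /\
  (forall k x u n, lpa_homog k x -> pr u n x = if n == k then x ** u else 0).
Proof.
have [phi [phiH phiv phie phig]] := lpa_univ shift_mul_leavitt.
exists (fun u n x => phi x (fun j => if j == 0 then u else 0) n); split.
  by move=> u n x y; rewrite (nualg_homD phiH).
move=> k x u n xk; suff -> : phi x = shift_mul x k.
  by rewrite shift_mulE subr_eq0; case: eqP; rewrite ?numul0r.
move: x xk; apply: lpa_homog_ind => [|x y xk yk|a v s w t <-].
- by rewrite shift_mul0 (nualg_hom0 phiH).
- by rewrite shift_mulD (nualg_homD phiH) xk yk.
have phir : phi (realw R v s) = shift_mul (realw R v s) (size s)%:Z.
  elim/last_ind: s => [|s e IH]; first exact: phiv.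
  rewrite realw_rcons (nualg_homM phiH) IH phie shift_mulM size_rcons.
  by congr shift_mul; lia.
have phigh : phi (ghostw R w t) = shift_mul (ghostw R w t) (- (size t)%:Z).
  elim: t w => [|e t IH] w /=; first exact: phiv.
  rewrite (nualg_homM phiH) IH phig shift_mulM.
  by congr shift_mul; lia.
by rewrite (nualg_homZ phiH) (nualg_homM phiH) phir phigh shift_mulM shift_mulZ.
Qed.

(** A finite sum of distinct vertices is a right unit for [x] as soon as it
    contains the sources of the paths [beta] in the monomials [alpha beta^*] of
    [x]. *)
Lemma lpa_right_unit x : exists r : seq (vertex E), forall r',
  uniq r' -> {subset r <= r'} -> x = \sum_(w <- r') x ** vert w.
Proof.
elim/lpa_ind: x => [|x y [r rx] [r' ry]|a v s w t].
- by exists [::] => r' _ _; rewrite big1// => w _; rewrite numul0l.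
- exists (r ++ r') => q qu qs; under eq_bigr do rewrite numulDl.
  rewrite big_split /= -rx -?ry// => w wr; apply: qs;
    by rewrite mem_cat wr ?orbT.
exists [:: gsrc w t] => q qu qs; under eq_bigr do rewrite -nuscalerAl mono_vert.
rewrite -scaler_sumr -big_mkcond/= -big_filter.
under eq_filter do rewrite eq_sym.
by rewrite filter_pred1_uniq ?big_seq1//; apply: qs; rewrite inE.
Qed.

End Grading.

(** * Direct sum decompositions of ideals *)

Section Decompositions.
Variables (R : comNzRingType) (E : graph).
Local Notation L := (lpa R E).
Local Notation vert := (@vert R E).

Lemma decomposition_component : exists pr : L -> int -> L -> L,
  forall x c u n, decomposition (@lpa_homog R E) x c -> pr u n x = c n ** u.
Proof.
have [pr [prD prh]] := graded_component R E; exists pr => x c u n [ch cfin ->].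
have pr0 : pr u n 0 = 0 by apply: (@addrI _ (pr u n 0)); rewrite -prD !addr0.
rewrite (big_morph (pr u n) (prD u n) pr0).
under eq_bigr => k _ do rewrite (prh _ _ _ _ (ch k)) eq_sym.
rewrite -big_mkcond -big_filter.
have fs : finite_set (setT `&` c @^-1` [set~ 0]) by rewrite setTI.
have := in_finite_support fs; have := finite_support_uniq 0 setT c.
move: (finite_support _ _ _) => r ru rP.
have [nr|nr] := boolP (n \in r); first by rewrite filter_pred1_uniq ?big_seq1.
have -> : c n = 0.
  by apply: contrapT => cn; move: nr; rewrite rP => /negP; apply; apply/mem_set.
rewrite numul0l big_filter big1_seq// => k /andP[/eqP -> kr].
by rewrite kr in nr.
Qed.

Lemma decomposition_unique x c d : decomposition (@lpa_homog R E) x c ->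
  decomposition (@lpa_homog R E) x d -> c =1 d.
Proof.
have [pr prP] := decomposition_component => xc xd n.
apply/eqP; rewrite -subr_eq0; apply/eqP.
have [r rP] := lpa_right_unit (c n - d n).
rewrite (rP (undup r)) ?undup_uniq//; last by move=> w; rewrite mem_undup.
apply: big1 => w _.
by rewrite numulDl numulNl -(prP _ _ _ _ xc) -(prP _ _ _ _ xd) subrr.
Qed.

Variable I : set L.
Hypothesis II : two_sided_ideal I.

(** The sums of homogeneous elements of [I] form the largest graded ideal
    inside [I]. *)
Definition homog_sum x := exists l : seq (int * L),
  (forall i, i \in l -> I i.2 /\ lpa_homog i.1 i.2) /\ x = \sum_(i <- l) i.2.

Lemma homog_sum0 : homog_sum 0.
Proof. by exists [::]; rewrite big_nil. Qed.

Lemma homog_sumD x y : homog_sum x -> homog_sum y -> homog_sum (x + y).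
Proof.
move=> [l [lI ->]] [l' [lI' ->]].
exists (l ++ l'); rewrite big_cat; split=> // i.
by rewrite mem_cat => /orP[/lI|/lI'].
Qed.

Lemma homog_sum1 k x : I x -> lpa_homog k x -> homog_sum x.
Proof.
move=> Ix xk; exists [:: (k, x)]; rewrite big_seq1; split=> // i.
by rewrite inE => /eqP ->.
Qed.

Lemma homog_sum_sum (J : eqType) (r : seq J) (F : J -> L) :
  (forall i, i \in r -> homog_sum (F i)) -> homog_sum (\sum_(i <- r) F i).
Proof.
move=> h; rewrite big_seq; elim/big_rec: _ => [|i x /h].
  exact: homog_sum0.
exact: homog_sumD.
Qed.

Lemma homog_sum_ghost x e : homog_sum x -> homog_sum (x ** ghost R e).
Proof.
move=> [l [lI ->]]; rewrite numul_suml; apply: homog_sum_sum => i /lI [Ii hi].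
have := homog_sum1 (nuidealMr II (ghost R e) Ii) (lpa_homog_ghost e hi). exact.
Qed.

Lemma homog_sum_decomposition x : homog_sum x ->
  exists c, decomposition (fun k => I `&` lpa_homog k) x c.
Proof.
move=> [l [lI ->]]; exists (fun k => \sum_(i <- l | i.1 == k) i.2).
pose r := undup (map fst l).
have c0 k : k \notin r -> \sum_(i <- l | i.1 == k) i.2 = 0.
  move=> kr; apply: big1_seq => i /andP[/eqP ik il]; case/negP: kr.
  by rewrite mem_undup -ik map_f.
split=> [k||].
- split; rewrite big_seq_cond; elim/big_rec: _.
  + exact: nuideal0 II.
  + by move=> i y /andP[/lI[Ii _] _]; apply: nuidealD II _ _ Ii.
  + exact: lpa_homog0.
  + by move=> i y /andP[/lI[_ hi] /eqP <-]; apply: lpa_homogD hi.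
- apply: (sub_finite_set _ (finite_seq r)) => k /= ck.
  by apply: contrapT => /negP /c0.
rewrite (fsbigE r) ?undup_uniq//; last by move=> k _; apply: c0.
rewrite (exchange_big_dep xpredT)//= big_seq [RHS]big_seq.
apply: eq_bigr => i il.
rewrite -big_filter; under eq_filter do rewrite in_setT eq_sym.
by rewrite filter_pred1_uniq ?undup_uniq ?big_seq1// mem_undup map_f.
Qed.

Lemma graded_of_homog_sum : (forall x, I x -> homog_sum x) -> graded I.
Proof.
move=> h; split=> [x|x c d [ch cf xc] [dh df xd]]; last first.
  apply: (@decomposition_unique x); split=> // k; first by have [] := ch k.
  by have [] := dh k.
split=> [/h/homog_sum_decomposition//|[c [ch _ ->]]].
elim/big_rec: _ => [|k y _]; first exact: nuideal0 II.
by apply: nuidealD => //; have [] := ch k.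
Qed.

End Decompositions.

(** * Closed walks *)

Section ClosedWalks.
Variable E : graph.
Implicit Types (v w : vertex E) (e : edge E) (s t p q g : seq (edge E)).

Definition cwalk v s := walk v s && (pend v s == v).

Definition simple_cwalk v s :=
  [/\ s != [::], cwalk v s & forall e, e \in behead s -> src e <> v].

Lemma cwalk_cat v s t : cwalk v s -> cwalk v (s ++ t) = cwalk v t.
Proof. by case/andP=> ws /eqP es; rewrite /cwalk walk_cat pend_cat es ws. Qed.

Lemma condition_K_cwalk v s : condition_K E -> s != [::] -> cwalk v s ->
  exists p q, [/\ p <> q, simple_cwalk v p & simple_cwalk v q].
Proof.
move=> /(_ v)[noc|[p [q [pq ps qs]]]] s0 /andP[ws /eqP es].
  by case: (noc (exist _ (v, s) ws)); split=> //; rewrite /plen lt0n size_eq0.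
have H (r : gpath E) : simple_closed_path_at v r ->
    psrc r = v /\ simple_cwalk v (pedges r).
  case: r => [[u r] wr]; rewrite /simple_closed_path_at /closed_path_at.
  rewrite /prng /psrc /plen /pedges /=.
  move=> [[r0 uv rv] rs]; split=> //; move: wr rv; rewrite uv /= => wr rv.
  by split=> //; [rewrite -size_eq0 -lt0n | apply/andP; split=> //; apply/eqP].
have [pv pw] := H p ps; have [qv qw] := H q qs.
exists (pedges p), (pedges q); split=> // e; apply: pq; apply: val_inj.
rewrite [LHS]surjective_pairing [RHS]surjective_pairing.
by congr pair => //; apply: etrans pv (esym qv).
Qed.

(** Otherwise the first edge of [p] after [g] would start at [v] again. *)
Lemma simple_cwalk_prefix v p g : simple_cwalk v p -> cwalk v g -> g != [::] ->
  prefix g p -> g = p.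
Proof.
move=> [p0 /andP[wp _] ps] /andP[wg /eqP eg] g0 /prefixP[[|e u] pgu].
  by rewrite cats0 in pgu.
move: wp ps; rewrite pgu walk_cat eg /= => /and3P[_ /eqP ev _] /(_ e) [] //.
by case: g {wg eg pgu} g0 => //= a g _; rewrite mem_cat inE eqxx orbT.
Qed.

Lemma prefix_total (T : eqType) (a b c : seq T) :
  prefix a c -> prefix b c -> prefix a b || prefix b a.
Proof.
wlog ab : a b / (size a <= size b)%N => [H pa pb|].
  by case: (leqP (size a) (size b)) => [|/ltnW] /H; [|rewrite orbC]; apply.
rewrite !prefixE => /eqP pa /eqP pb; apply/orP; left.
by rewrite -[in X in take _ X]pb take_takel// pa.
Qed.

(** Two distinct simple closed walks at [v] are incomparable for the prefix
    order.  If [g] is not empty it must therefore start with [p], and one [p]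
    can be stripped from both words; when [g] is exhausted, [q] is left facing
    a word that starts with [p].  The exponent [M], larger than [N] at that
    point, is what the induction needs; the case of interest is [M = N]. *)
Lemma power_not_prefix v p q N M g : p <> q ->
  simple_cwalk v p -> simple_cwalk v q -> cwalk v g ->
  (size g <= N <= M)%N -> (g != [::]) || (N < M)%N ->
  ~~ prefix (flatten (nseq N p) ++ q) (g ++ flatten (nseq M p) ++ q).
Proof.
move=> pq sp sq; have [p0 cp _] := sp; have [q0 cq _] := sq.
elim: N M g => [|N IH] M g cg.
  rewrite leqn0 size_eq0 => /andP[/eqP -> _] /=; case: M => // M _ /=.
  rewrite -catA; apply/negP => qp.
  have /orP[qp'|pq'] := prefix_total qp (prefix_prefix p _); apply: pq.
    by rewrite (simple_cwalk_prefix sp cq q0 qp').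
  by rewrite (simple_cwalk_prefix sq cp p0 pq').
case/andP=> gN NM; case: (eqVneq g [::]) => [-> /=|g0 _].
  case: M NM => // M NM NM'; rewrite -!catA prefix_catr// eqxx.
  apply: (IH M [::]) => //; first by rewrite /cwalk /pend /= eqxx.
rewrite /= -catA; apply/negP => pre; have /prefixP[u gu] : prefix p g.
  have pp := prefix_trans (prefix_prefix p _) pre.
  have /orP[//|gp] := prefix_total pp (prefix_prefix g _).
  by rewrite (simple_cwalk_prefix sp cg g0 gp) prefix_refl.
move: cg gN pre; rewrite gu cwalk_cat// => cu uN.
rewrite -!catA prefix_catr// eqxx /=; apply/negP.
apply: IH => //; last by rewrite NM orbT.
rewrite (ltnW NM) andbT; move: uN; rewrite size_cat.
case: (p) p0 => // a r _ /=; rewrite addSn ltnS.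
by apply: leq_trans; apply: leq_addl.
Qed.

End ClosedWalks.

(** * Basic ideals under Condition (K) *)

Section ConditionK.
Variables (R : comNzRingType) (E : graph).
Local Notation L := (lpa R E).
Local Notation vert := (@vert R E).
Local Notation real := (@real R E).
Local Notation ghost := (@ghost R E).
Local Notation realw := (@realw R E).
Local Notation ghostw := (@ghostw R E).
Implicit Types (v w : vertex E) (e : edge E) (s t g : seq (edge E)) (x : L).

Let LF := lpa_leavitt_family R E.

Variable I : set L.
Hypotheses (II : two_sided_ideal I) (IB : basic I) (KE : condition_K E).

(** With [m = p^N q] and [N] at least the length of all the closed walks,
    conjugation by [m] kills every one of them and leaves [r w]. *)
Lemma vertex_in_basic w (r : R) (l : seq (R * seq (edge E))) : r != 0 ->
  (forall i, i \in l -> i.2 != [::] /\ cwalk w i.2) ->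
  I (r *: vert w + \sum_(i <- l) i.1 *: realw w i.2) -> I (vert w).
Proof.
move=> r0; case: l => [_|i0 l lc Iy].
  by rewrite big_nil addr0; apply: IB; apply/eqP.
have [i00 i0c] := lc i0 (mem_head _ _).
have [p [q [pq sp sq]]] := condition_K_cwalk KE i00 i0c.
set l' := i0 :: l in lc Iy; pose N := \max_(i <- l') size i.2.
pose m := flatten (nseq N p) ++ q.
have cm : cwalk w m.
  rewrite /m; elim: (N) => [|k IH]; first by case: sq.
  by rewrite /= -catA cwalk_cat; case: sp.
have [wm /eqP em] := andP cm.
have mm : ghostw w m ** realw w m = vert w.
  by rewrite ghostw_realw// eqxx prefix_refl em drop_size.
have mg g : cwalk w g -> g != [::] -> (size g <= N)%N ->
    ghostw w m ** realw w g ** realw w m = 0.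
  move=> /[dup] cg /andP[wg /eqP eg] g0 gN; rewrite -numulA -[X in realw X m]eg.
  rewrite -realw_cat ghostw_realw//; last by rewrite size_cat leq_addl.
  rewrite (negPf (power_not_prefix _ sp sq cg _ _)) ?andbF//.
  - by rewrite gN leqnn.
  - by rewrite g0.
have : I (ghostw w m ** (r *: vert w + \sum_(i <- l') i.1 *: realw w i.2)
    ** realw w m).
  by apply: nuidealMr => //; apply: nuidealMl.
rewrite numulDr numulDl numul_sumr numul_suml big1_seq.
  rewrite addr0 -nuscalerAr -nuscalerAl -numulA vert_realw eqxx mm.
  by apply: IB; apply/eqP.
move=> i /andP[_ il]; have [i_0 ic] := lc i il.
rewrite -nuscalerAr -nuscalerAl mg ?scaler0//.
exact: (@leq_bigmax_seq _ l' xpredT (fun i => size i.2) i il isT).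
Qed.

Lemma seq_argmin (T : eqType) (h : T -> nat) (l : seq T) : l != [::] ->
  exists2 i, i \in l & forall j, j \in l -> (h i <= h j)%N.
Proof.
case: l => // i0 l _; set l' := i0 :: l.
have ex : exists n, has (fun i => h i == n) l'.
  by exists (h i0); rewrite /= eqxx.
case: (ex_minnP ex) => n /hasP[i il /eqP hi] min; exists i => // j jl.
by rewrite hi min//; apply/hasP; exists j.
Qed.

(** A shortest walk is singled out and its total coefficient [r] is collected.
    If [r = 0] that walk can be dropped; otherwise multiplying by its ghost
    turns the remaining walks into closed walks at [w], of positive length by
    minimality, so that [w] is in [I] and all the terms are in [I] too. *)
Lemma homog_sum_real w (l : seq (R * (vertex E * seq (edge E)))) :
  (forall i, i \in l -> walk i.2.1 i.2.2 /\ pend i.2.1 i.2.2 = w) ->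
  I (\sum_(i <- l) i.1 *: realw i.2.1 i.2.2) ->
  homog_sum I (\sum_(i <- l) i.1 *: realw i.2.1 i.2.2).
Proof.
have [n] := ubnP (size l); elim: n l => // n IH l ln lw.
have [->|l0] := eqVneq l [::]; first by rewrite big_nil => _; apply: homog_sum0.
have [i0 i0l i0min] := seq_argmin (fun i => size i.2.2) l0.
move: i0 i0l i0min => [a0 [v0 s0]] /= i0l i0min.
have [/= w0 e0] := lw _ i0l.
set x := \sum_(i <- l) _.
have xE : x = (\sum_(i <- l | i.2 == (v0, s0)) i.1) *: realw v0 s0
    + \sum_(i <- [seq i <- l | i.2 != (v0, s0)]) i.1 *: realw i.2.1 i.2.2.
  rewrite /x (bigID (fun i => i.2 == (v0, s0)))/= scaler_suml big_filter.
  by congr (_ + _); apply: eq_bigr => i /eqP ->.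
have [r0|r0] := eqVneq (\sum_(i <- l | i.2 == (v0, s0)) i.1) 0.
  rewrite xE r0 scale0r add0r; apply: IH => [|i].
    rewrite ltnS in ln; apply: leq_trans ln; rewrite size_filter.
    rewrite -(count_predC (fun i => i.2 == (v0, s0)) l) -addn1 addnC leq_add2r.
    by rewrite -has_count; apply/hasP; exists (a0, (v0, s0)).
  by rewrite mem_filter => /andP[_ /lw].
move=> Ix; have Iw : I (vert w).
  pose l' := [seq i <- l |
    (i.2 != (v0, s0)) && ((v0 == i.2.1) && prefix s0 i.2.2)].
  apply: (@vertex_in_basic w _ [seq (i.1, drop (size s0) i.2.2) | i <- l'] r0).
    move=> _ /mapP[[a [v s]] + ->]; rewrite mem_filter /=.
    move=> /andP[/andP[vs /andP[/eqP v0v /prefixP[g sg]]] /lw /= [ws es]].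
    move: vs ws es; rewrite -v0v sg drop_size_cat// walk_cat pend_cat e0.
    move=> vs /andP[_ wg] eg.
    split; last by rewrite /cwalk wg eg eqxx.
    by apply: contra_neq vs => ->; rewrite cats0.
  have := nuidealMl II (ghostw v0 s0) Ix.
  rewrite xE numulDr -nuscalerAr ghostw_realw// eqxx prefix_refl e0 drop_size.
  congr (I (_ + _)); rewrite numul_sumr !big_map.
  rewrite /l' !big_filter [RHS]big_mkcondr big_seq_cond [RHS]big_seq_cond /=.
  apply: eq_bigr => i /andP[il _].
  rewrite -nuscalerAr ghostw_realw ?e0 ?i0min//.
  by case: ifP; rewrite ?scaler0.
apply: homog_sum_sum => -[a [v s]] /lw /= [ws es].
apply: (@homog_sum1 _ _ _ (size s)%:Z).
  rewrite -[realw v s](_ : realw v s ** vert w = _) ?nuscalerAl.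
    exact: nuidealMl.
  by rewrite realw_vert es eqxx.
exact/lpa_homogZ/lpa_homog_real.
Qed.

Definition ghost_bounded n x :=
  exists l : seq (R * (vertex E * seq (edge E)) * (vertex E * seq (edge E))),
  (forall i, i \in l -> (size i.2.2 <= n)%N) /\
  x = \sum_(i <- l) i.1.1 *: mono R i.1.2.1 i.1.2.2 i.2.1 i.2.2.

Lemma ghost_bounded0 n : ghost_bounded n 0.
Proof. by exists [::]; rewrite big_nil. Qed.

Lemma ghost_boundedD n x y :
  ghost_bounded n x -> ghost_bounded n y -> ghost_bounded n (x + y).
Proof.
move=> [l [lI ->]] [l' [lI' ->]].
exists (l ++ l'); rewrite big_cat; split=> // i.
by rewrite mem_cat => /orP[/lI|/lI'].
Qed.

Lemma ghost_bounded_mono n a v s w t : (size t <= n)%N ->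
  ghost_bounded n (a *: mono R v s w t).
Proof.
move=> tn; exists [:: (a, (v, s), (w, t))]; rewrite big_seq1; split=> // i.
by rewrite inE => /eqP ->.
Qed.

Lemma ghost_bounded_ind n (P : L -> Prop) : P 0 ->
  (forall x y, P x -> P y -> P (x + y)) ->
  (forall a v s w t, (size t <= n)%N -> P (a *: mono R v s w t)) ->
  forall x, ghost_bounded n x -> P x.
Proof.
move=> P0 PD PM x [l [ln ->]]; rewrite big_seq.
elim/big_rec: _ => // i y /ln il.
exact: PD (PM _ _ _ _ _ il).
Qed.

Lemma ghost_boundedW n m x :
  (n <= m)%N -> ghost_bounded n x -> ghost_bounded m x.
Proof.
by move=> nm [l [ln ->]]; exists l; split=> // i /ln/leq_trans; apply.
Qed.

Lemma ghost_bounded_ex x : exists n, ghost_bounded n x.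
Proof.
elim/lpa_ind: x => [|x y [n xn] [m ym]|a v s w t].
- by exists 0; apply: ghost_bounded0.
- exists (maxn n m); apply: ghost_boundedD.
    by apply: ghost_boundedW xn; apply: leq_maxl.
  by apply: ghost_boundedW ym; apply: leq_maxr.
- by exists (size t); apply: ghost_bounded_mono.
Qed.

Lemma ghost_bounded_real n x e :
  ghost_bounded n.+1 x -> ghost_bounded n (x ** real e).
Proof.
apply: (ghost_bounded_ind (P := fun x => ghost_bounded n (x ** real e)))
  => [|y z yn zn|a v s w t tn].
- by rewrite numul0l; apply: ghost_bounded0.
- by rewrite numulDl; apply: ghost_boundedD.
rewrite -nuscalerAl.
have [->|[s' [w' [t' [-> _ tt']]]]] := mono_real R v s w t e.
  by rewrite scaler0; apply: ghost_bounded0.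
by apply: ghost_bounded_mono; lia.
Qed.

Lemma ghost_bounded_sink n x w : (forall e, src e <> w) -> ghost_bounded n x ->
  ghost_bounded 0 (x ** vert w).
Proof.
move=> sw.
apply: (ghost_bounded_ind (P := fun x => ghost_bounded 0 (x ** vert w)))
  => [|y z yn zn|a v s w' t _].
- by rewrite numul0l; apply: ghost_bounded0.
- by rewrite numulDl; apply: ghost_boundedD.
rewrite -nuscalerAl mono_vert; case: eqP => wt; last first.
  by rewrite scaler0; apply: ghost_bounded0.
by case: t wt => [|e t] /=; [move=> _; apply: ghost_bounded_mono | move=> /sw].
Qed.

Lemma homog_sum_vert x : (forall w, homog_sum I (x ** vert w)) -> homog_sum I x.
Proof.
have [r rx] := lpa_right_unit x => h.
rewrite (rx (undup r)) ?undup_uniq//; last by move=> w; rewrite mem_undup.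
exact: homog_sum_sum.
Qed.

Lemma homog_sum_ghost_free x : ghost_bounded 0 x -> I x -> homog_sum I x.
Proof.
move=> [l [l0 xl]] Ix; apply: homog_sum_vert => w.
have := nuidealMr II (vert w) Ix.
(* the other terms of [x ** vert w] vanish *)
pose l' := [seq (i.1.1, i.1.2) | i <- l & [&& i.2.1 == w,
  walk i.1.2.1 i.1.2.2 & pend i.1.2.1 i.1.2.2 == w]].
suff -> : x ** vert w = \sum_(i <- l') i.1 *: realw i.2.1 i.2.2.
  apply: (@homog_sum_real w) => _ /mapP[i + ->] /=.
  by rewrite mem_filter => /andP[/and3P[_ ws /eqP]].
rewrite /l' big_map big_filter xl numul_suml [RHS]big_mkcond.
rewrite big_seq [RHS]big_seq.
apply: eq_bigr => -[[a [v s]] [u t]] /l0 /=.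
rewrite leqn0 size_eq0 => /eqP ->.
rewrite -nuscalerAl mono_vert /mono /= realw_vert.
case: (u =P w) => [->|_] /=; last by rewrite scaler0.
have [ws|/realw_nwalk ->] := boolP (walk v s); last by rewrite if_same scaler0.
by case: ifP; rewrite ?scaler0.
Qed.

(** Ghost paths are shortened one edge at a time: [x w] is the sum of the
    [(x e) e^*] over the edges [e] from [w], unless [w] is a sink, at which no
    ghost path of positive length can end. *)
Lemma basic_homog_sum (hE : row_finite E) x : I x -> homog_sum I x.
Proof.
have [n xn] := ghost_bounded_ex x.
elim: n x xn => [|n IH] x xn Ix; first exact: homog_sum_ghost_free.
apply: homog_sum_vert => w; have [sw|] := pselect (forall e, src e <> w).
  apply: homog_sum_ghost_free; first exact: ghost_bounded_sink xn.
  exact: nuidealMr.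
move=> /existsNP[e0 /contrapT we0].
have wr : regular w by split; [exists e0 | apply: hE].
rewrite (lf_ck2 LF wr) fsbig_finite// numul_sumr.
apply: homog_sum_sum => e _; rewrite numulA; apply: homog_sum_ghost => //.
by apply: IH; [apply: ghost_bounded_real | apply: nuidealMr].
Qed.

End ConditionK.

(** * Representations on functions of infinite paths *)

Section InfinitePaths.
Variables (R : comNzRingType) (E : graph).
Implicit Types (v w : vertex E) (e : edge E) (x y : nat -> edge E).

Definition spath_shift x : nat -> edge E := fun i => x i.+1.
Definition spath_cons e x : nat -> edge E :=
  fun i => if i is j.+1 then x j else e.

Lemma spath_consK x : spath_cons (x 0) (spath_shift x) = x.
Proof. by apply/funext => -[]. Qed.

Variable X : set (nat -> edge E).
Hypotheses (X_chain : forall x, X x -> rng (x 0) = src (x 1))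
  (X_shift : forall x, X x -> X (spath_shift x))
  (X_cons : forall x e, X x -> rng e = src (x 0) -> X (spath_cons e x)).

Local Notation M := ((nat -> edge E) -> R^o).

(** Functions are taken on all sequences of edges, and the operators vanish
    outside [X]: this replaces functions on the subtype [X]. *)
Definition spath_op (P : pred (nat -> edge E))
  (h : (nat -> edge E) -> nat -> edge E) (f : M) : M :=
  fun x => if `[< X x >] && P x then f (h x) else 0.

Lemma spath_op_linear P h : is_linear (spath_op P h).
Proof.
apply/asboolP => a f g; apply/funext => x; rewrite /spath_op.
rewrite -![(a *: _ + _) _]/(a *: _ + _ : R^o).
by case: ifP => // _; rewrite scaler0 addr0.
Qed.

Definition spath_endo P h : endo M := Endo (spath_op_linear P h).

Definition spath_vert v := spath_endo (fun x => src (x 0) == v) id.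
Definition spath_real e := spath_endo (fun x => x 0 == e) spath_shift.
Definition spath_ghost e :=
  spath_endo (fun x => src (x 0) == rng e) (spath_cons e).

Lemma spath_leavitt : leavitt_family spath_vert spath_real spath_ghost.
Proof.
have X_cons' x e : X x -> src (x 0) == rng e -> `[< X (spath_cons e x) >].
  by move=> Xx /eqP xe; apply/asboolP/X_cons.
have X_shift' x : X x -> `[< X (spath_shift x) >].
  by move=> Xx; apply/asboolP/X_shift.
split; last first.
  move=> v vr; apply: endoP => f; apply/funext => x.
  rewrite fsbig_finite ?endo_sum; last by case: vr.
  rewrite fct_sumE; under eq_bigr => e _.
    have -> : (spath_real e ** spath_ghost e) f x =
        if x 0 == e then spath_vert (src e) f x else 0.
      rewrite endoM /= /spath_op.
      case: asboolP => [Xx|_] /=; last by rewrite if_same.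
      case: eqP => // <-; rewrite X_shift'//= -X_chain// !eqxx /=.
      by rewrite spath_consK.
    over.
  rewrite -big_mkcond -big_filter; under eq_filter do rewrite eq_sym.
  have [xv|xv] := eqVneq (src (x 0)) v.
    rewrite filter_pred1_uniq ?big_seq1 ?xv//.
    rewrite in_fset_set; last by case: vr.
    exact/mem_set.
  rewrite big_filter big1_seq /= => [|e /andP[/eqP -> ]].
    by rewrite /spath_op (negPf xv) andbF.
  rewrite in_fset_set; last by case: vr.
  by rewrite inE => /eqP; rewrite (negPf xv).
all: move=> *; apply: endoP => f'; apply/funext => x;
  rewrite ?endoM /= /spath_op; (case: asboolP => [Xx|//]) => /=.
- by case: eqP => // /eqP xe; rewrite X_cons'//=; case: eqP.
- by case: ifP => // xe; rewrite X_cons'//= eqxx.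
- by case: ifP => // xe; rewrite X_cons'//= eqxx.
- by case: eqP.
- by case: eqP => // xe; rewrite X_shift'//= /spath_shift -X_chain// xe eqxx.
- by case: (x 0 =P _) => [->|_]; rewrite ?eqxx ?if_same.
- by case: eqP => // ->; case: eqP.
- by case: eqP.
Qed.

End InfinitePaths.

(** * Ideals when Condition (K) fails *)

Section RecurrentPaths.
Variables (R : comNzRingType) (E : graph).
Implicit Types (v w : vertex E) (e : edge E) (x y : nat -> edge E).

Definition recurrent v : set (nat -> edge E) := [set x |
  (forall i, rng (x i) = src (x i.+1)) /\
  (forall n, exists2 m, (n <= m)%N & src (x m) = v)].

Lemma recurrent_shift v (n : nat) x :
  recurrent v x -> recurrent v (fun i => x (n + i)%N).
Proof.
move=> [xc xr]; split=> [i|k]; first by rewrite addnS.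
have [m km mv] := xr (n + k)%N; exists (m - n)%N; first lia.
by rewrite subnKC//; lia.
Qed.

Lemma recurrent_cons v x e : recurrent v x -> rng e = src (x 0) ->
  recurrent v (spath_cons e x).
Proof.
move=> [xc xr] ex; split=> [|n]; first by case.
have [m nm mv] := xr n.
by exists m.+1 => //; apply: leqW.
Qed.

Lemma chain_walk x : (forall i, rng (x i) = src (x i.+1)) -> forall n,
  walk (src (x 0)) (mkseq x n) /\ pend (src (x 0)) (mkseq x n) = src (x n).
Proof.
move=> xc; elim=> [|n [wn en]] //.
rewrite mkseqS -cats1 walk_cat pend_cat wn en /= eqxx; split=> //.
by rewrite /pend /= xc.
Qed.

(** Up to its first return to [v], a recurrent path runs through a simple closed
    path. *)
Lemma first_return v x : recurrent v x -> src (x 0) = v ->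
  exists n, exists p : gpath E, [/\ (0 < n)%N, src (x n) = v,
    pedges p = mkseq x n & simple_closed_path_at v p].
Proof.
move=> [xc xr] x0.
have ex : exists n, (0 < n)%N && (src (x n) == v).
  by have [m m0 mv] := xr 1; exists m; rewrite m0 mv eqxx.
case: (ex_minnP ex) => n /andP[n0 /eqP nv] min.
have [wn en] := chain_walk xc n; rewrite x0 in wn en.
exists n, (exist _ (v, mkseq x n) wn); split=> //; split.
  split; rewrite /plen /pedges /prng /psrc /= ?size_mkseq//.
  by rewrite -[RHS]nv -en.
move=> e; rewrite /pedges /=; case: n n0 min {nv wn en} => // n _ min.
move=> /mapP[j]; rewrite mem_iota => /andP[j0 jn] -> jv.
by have := min j; rewrite jv eqxx andbT j0 => /(_ isT); lia.
Qed.

(** Between two visits of [v] the path has no choice: its first stretch is the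
    only simple closed path at [v], and the rest is again recurrent. *)
Lemma recurrent_unique v :
  (forall p q : gpath E,
    simple_closed_path_at v p -> simple_closed_path_at v q -> p = q) ->
  forall x y, recurrent v x -> recurrent v y ->
  src (x 0) = v -> src (y 0) = v -> x = y.
Proof.
move=> pq x y xr yr x0 y0; apply/funext => k.
elim/ltn_ind: k x y xr yr x0 y0 => k IH x y xr yr x0 y0.
have [n [p [n0 nv pE ps]]] := first_return xr x0.
have [m [q [m0 mv qE qs]]] := first_return yr y0.
have xy : mkseq x n = mkseq y m by rewrite -pE -qE (pq p q).
have nm : n = m by rewrite -(size_mkseq x n) xy size_mkseq.
rewrite -nm in xy mv; have [kn|nk] := ltnP k n.
  by rewrite -(nth_mkseq (x 0) x kn) xy nth_mkseq.
rewrite -(subnKC nk).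
apply: (IH (k - n)%N _ (fun i => x (n + i)%N) (fun i => y (n + i)%N)).
- by lia.
- exact: recurrent_shift.
- exact: recurrent_shift.
- by rewrite addn0.
- by rewrite addn0.
Qed.

(** The witness is the periodic path [s s s ...]. *)
Lemma recurrent_ex v s : s != [::] -> cwalk v s ->
  exists2 x, recurrent v x & src (x 0) = v.
Proof.
case: s => // e0 s0; set s := e0 :: s0 => _ /andP[ws /eqP es].
have s_src i : (i < size s)%N -> src (nth e0 s i) = pend v (take i s).
  move=> si; move: ws.
  rewrite -{1}(cat_take_drop i s) walk_cat (drop_nth e0)//=.
  by case/and3P => _ /eqP.
have s_rng i : (i < size s)%N -> rng (nth e0 s i) = pend v (take i.+1 s).
  by move=> si; rewrite (take_nth e0)// /pend map_rcons last_rcons.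
exists (fun i => nth e0 s (i %% size s)); last by rewrite mod0n s_src// take0.
split=> [i|n].
  rewrite s_rng ?ltn_pmod// s_src ?ltn_pmod// modnS; case: ifP => [|//].
  move=> /dvdnP[k ik].
  have -> : (i %% size s).+1 = size s.
    apply/eqP; rewrite eqn_leq ltn_pmod// dvdn_leq//.
    by rewrite -addn1 /dvdn modnDml addn1 -/(dvdn _ _) ik dvdn_mull.
  by rewrite take_size take0 es.
exists (n * size s)%N; first by rewrite leq_pmulr.
by rewrite modnMl s_src// take0.
Qed.

Lemma spath_realwE (phi : lpa R E -> endo ((nat -> edge E) -> R^o)) v X :
  nualg_hom phi -> (forall w, phi (vert R w) = spath_vert R X w) ->
  (forall e, phi (real R e) = spath_real R X e) ->
  (forall x, X x -> X (spath_shift x)) ->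
  forall n f x, X x -> src (x 0) = v ->
  phi (realw R v (mkseq x n)) f x = f (fun i => x (n + i)%N).
Proof.
move=> phiH phiv phie Xs n f x Xx x0; elim: n f => [|n IH] f.
  rewrite [realw _ _ _]/(vert R v) phiv /= /spath_op x0 eqxx.
  by case: asboolP.
have Xn : X (fun i => x (n + i)%N).
  elim: n {IH} => [//|n /Xs]; rewrite /spath_shift.
  by under eq_fun do rewrite -addSnnS.
rewrite mkseqS realw_rcons (nualg_homM phiH) endoM IH phie /= /spath_op.
rewrite addn0 eqxx.
case: asboolP => //= _; congr f; apply/funext => i.
by rewrite /spath_shift addSnnS.
Qed.

(** The ideal is the kernel of the representation on functions of the paths
    recurrent at [v].  It contains [v - p], where [p] is the first return loop
    of the recurrent path [x], but not the component [v] in degree 0. *)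
Lemma not_condition_K_not_graded v s : s != [::] -> cwalk v s ->
  (forall p q : gpath E,
    simple_closed_path_at v p -> simple_closed_path_at v q -> p = q) ->
  exists I : set (lpa R E), [/\ two_sided_ideal I, basic I & ~ graded I].
Proof.
move=> s0 cs pq; have [x xr x0] := recurrent_ex s0 cs.
have Xs y : recurrent v y -> recurrent v (spath_shift y).
  exact: (@recurrent_shift v 1).
have Xc y : recurrent v y -> rng (y 0) = src (y 1) by case.
have [phi [phiH phiv phie phig]] :=
  lpa_univ (spath_leavitt R Xc Xs (@recurrent_cons v)).
have [n [_ [n0 nv _ _]]] := first_return xr x0.
have xn : (fun i => x (n + i)%N) = x.
  apply: (recurrent_unique pq) => //; first exact: recurrent_shift.
  by rewrite addn0.
have phivv w f y : phi (vert R w) f y =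
    if `[< recurrent v y >] && (src (y 0) == w) then f y else 0.
  by rewrite phiv.
have Iv : phi (vert R v) <> 0.
  move=> /(congr1 (fun F : endo _ => F (fun=> 1) x)); rewrite phivv x0 eqxx.
  by case: asboolP => // _ /eqP; rewrite oner_eq0.
have Ip : phi (vert R v - realw R v (mkseq x n)) = 0.
  (* a factor [v] on the left leaves only the path [x], the one from [v] *)
  have -> : vert R v - realw R v (mkseq x n) =
      vert R v ** (vert R v - realw R v (mkseq x n)).
    by rewrite numulDr numulNr vertM vert_realw eqxx.
  apply: endoP => f; apply/funext => y; rewrite (nualg_homM phiH) endoM phivv.
  case: asboolP => //= yr; case: eqP => //= y0.
  rewrite (recurrent_unique pq yr xr y0 x0) (nualg_homD phiH) (nualg_homN phiH).
  rewrite endoD endoN -![(_ - _) x]/(_ x - _ x).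
  rewrite (spath_realwE phiH phiv phie Xs)// phivv x0 eqxx xn asboolT//=.
  by rewrite subrr.
exists [set z | phi z = 0]; split.
- exact: two_sided_ideal_ker.
- move=> a w /= a0; rewrite (nualg_homZ phiH) => aw.
  apply: endoP => f; apply/funext => y; rewrite phivv; case: ifP => // yw.
  have := congr1 (fun F : endo _ => F (fun=> 1) y) aw; rewrite endoZ.
  rewrite -![(a *: _) y]/(a * phi (vert R w) (fun=> 1) y) phivv yw mulr1.
  by move=> /a0.
pose d k : lpa R E := if k == 0 then vert R v else
  if k == n%:Z then - realw R v (mkseq x n) else 0.
have hd : decomposition (@lpa_homog R E) (vert R v - realw R v (mkseq x n)) d.
  have n0' : n%:Z != 0 by case: n n0 {nv xn Ip d}.
  split=> [k||].
  - rewrite /d; case: eqP => [->|_]; first exact: (lpa_homog_real R v [::]).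
    case: eqP => [->|_]; last exact: lpa_homog0.
    rewrite -scaleN1r; apply: lpa_homogZ.
    by have := lpa_homog_real R v (mkseq x n); rewrite size_mkseq.
  - apply: (sub_finite_set _ (finite_seq [:: 0; n%:Z])) => k /=.
    by rewrite /d !inE; case: eqP => //= _; case: eqP.
  rewrite (fsbigE [:: 0; n%:Z])//.
  - by rewrite !big_cons big_nil !in_setT /= addr0 /d eqxx (negPf n0') eqxx.
  - by rewrite /= inE eq_sym n0'.
  - by move=> k _; rewrite /d !inE negb_or => /andP[/negPf -> /negPf ->].
move=> [/(_ (vert R v - realw R v (mkseq x n)))[+ _] _].
move=> /(_ Ip)[c [ch cf xc]].
have cd : decomposition (@lpa_homog R E) (vert R v - realw R v (mkseq x n)) c.
  by split=> // k; have [] := ch k.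
apply: Iv; have [+ _] := ch 0; rewrite /= (decomposition_unique cd hd).
by rewrite /d eqxx.
Qed.

End RecurrentPaths.

Theorem theorem7p17 (R : comNzRingType) (E : graph) (hE : row_finite E) :
  condition_K E <->
  (forall I : set (lpa R E), two_sided_ideal I -> basic I -> graded I).
Proof.
split=> [KE I II IB|gr v].
  by apply: graded_of_homog_sum => // x; apply: basic_homog_sum.
apply: contrapT => /not_orP[nv npq].
have [p [p0 pv pe]] : exists p, closed_path_at v p.
  by apply: contrapT => np; apply: nv => p pv; apply: np; exists p.
have pq p' q' :
    simple_closed_path_at v p' -> simple_closed_path_at v q' -> p' = q'.
  by move=> sp sq; apply: contrapT => ne; apply: npq; exists p', q'.
have cp : cwalk v (pedges p).
  by rewrite /cwalk -[X in walk X]pv (valP p) -[X in pend X]pv; apply/eqP.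
have p_nil : pedges p != [::] by rewrite -size_eq0 -lt0n.
have [I [II IB]] := not_condition_K_not_graded R p_nil cp pq.
by apply; apply: gr.
Qed.
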